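(* Let $s\ge 2$. For every $j=1,\ldots,s$, let $K_j\subset\mathbb{C}$ be a compact set and let $(\eta^{(j)}_i)_{i\ge 0}\subset K_j$ be any sequence of pairwise distinct elements with $\eta^{(j)}_0\in\partial K_j$. Let $(H_n)_{n\ge 1}=(\eta_{k(n)})_{n\ge 1}\subset\mathbb{C}^s$ be the intertwining sequence of these $s$ sequences. Then the following are equivalent: (i) $(H_n)_{n\ge 1}$ is a Leja sequence for $K_1\times\cdots\times K_s$; (ii) for every $j=1,\ldots,s$, $(\eta^{(j)}_i)_{i\ge 0}$ is a Leja sequence for $K_j$.
   Context: Numeration of $\mathbb{N}^s$ ($\mathbb{N}=\{0,1,2,\ldots\}$): for $k=(k_1,\ldots,k_s)\in\mathbb{N}^s$ put $|k|=k_1+\cdots+k_s$. Order $\mathbb{N}^s$ by: $k\le l$ iff $|k|<|l|$, or $|k|=|l|$ and $k\le l$ in the lexicographic order (where $k<l$ lexicographically iff $k_1<l_1$, or $k_1=l_1,\ldots,k_t=l_t$ and $k_{t+1}<l_{t+1}$ for some $1\le t\le s-1$). Let $n\mapsto k(n)=(k_1(n),\ldots,k_s(n))$, $n\ge 1$, be the increasing enumeration of $\mathbb{N}^s$ for this order; e.g. for $s=3$: $k(1)=(0,0,0)$, $k(2)=(0,0,1)$, $k(3)=(0,1,0)$, $k(4)=(1,0,0)$, $k(5)=(0,0,2)$, $k(6)=(0,1,1),\ldots$ Intertwining sequence: given complex sequences $(\eta^{(j)}_i)_{i\ge0}$, $j=1,\ldots,s$, their intertwining sequence is $H_n=\eta_{k(n)}:=(\eta^{(1)}_{k_1(n)},\ldots,\eta^{(s)}_{k_s(n)})\in\mathbb{C}^s$,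 $n\ge 1$. Vandermonde determinant: let $e_n(z)=z_1^{k_1(n)}\cdots z_s^{k_s(n)}$, $n\ge1$. For $H_1,\ldots,H_N\in\mathbb{C}^s$, $\mathrm{VDM}(H_1,\ldots,H_N)=\det[e_i(H_j)]_{1\le i,j\le N}$. One-dimensional Leja sequence: a Leja sequence for a compact set $K\subset\mathbb{C}$ is a sequence $(\eta_i)_{i\ge 0}$ of elements of $K$ with $\eta_0\in\partial K$ and, for all $k\ge 1$, $\sup_{z\in K}\prod_{i=0}^{k-1}|z-\eta_i|=\prod_{i=0}^{k-1}|\eta_k-\eta_i|$. Multidimensional Leja sequence: a Leja sequence for a compact set $K\subset\mathbb{C}^s$ is a sequence $(H_n)_{n\ge 1}$ of elements of $K$ with $H_1\in\partial K$ and, for all $N\ge 1$, $|\mathrm{VDM}(H_1,\ldots,H_N,H_{N+1})|=\sup_{z\in K}|\mathrm{VDM}(H_1,\ldots,H_N,z)|$. *)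

(* Defs.v *)
From mathcomp Require Import all_boot all_order all_algebra.
From mathcomp Require Import all_classical all_reals all_analysis.
From mathcomp Require Import complex.

Set Implicit Arguments.
Unset Strict Implicit.
Unset Printing Implicit Defensive.

Import Order.TTheory GRing.Theory Num.Theory.
Import numFieldNormedType.Exports.

Local Open Scope classical_set_scope.
Local Open Scope ring_scope.

(** Conventions.  All sequences are indexed from 0; in particular a sequence
    written (x_n)_{n >= 1} on paper is represented by n |-> x_(n+1). *)

Section GradedLex.
Variable s : nat.
Implicit Types k l : s.-tuple nat.

Definition mi_deg k : nat := (\sum_(i < s) tnth k i)%N.

Definition mi_le k l : bool :=
  (mi_deg k < mi_deg l)%N ||
  ((mi_deg k == mi_deg l) && ((k : s.-tuplelexi nat) <= (l : s.-tuplelexi nat))%O).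

(* An entry of a multi-index of degree at most n is at most n, so this lists all
   the multi-indices of degree at most n, in increasing order. *)
Definition mi_upto (n : nat) : seq (s.-tuple nat) :=
  sort mi_le [seq k <- [seq map_tuple val t | t : s.-tuple 'I_n.+1]
             | (mi_deg k <= n)%N].

(* For s > 0 there are more than n multi-indices of degree at most n and they
   form an initial segment, so item n of [mi_upto n] is item n of the increasing
   enumeration of N^s; see [mi_enum_le] and [mi_enum_surj] below. *)
Definition mi_enum (n : nat) : s.-tuple nat :=
  nth (nseq_tuple s 0%N) (mi_upto n) n.

Lemma mi_le_total : total mi_le.
Proof.
move=> k l; rewrite /mi_le; case: (ltngtP (mi_deg k) (mi_deg l)) => //= _.
exact: le_total.
Qed.

Lemma mi_le_trans : transitive mi_le.
Proof.
move=> l k m; rewrite /mi_le => /orP[kl|/andP[/eqP-> kl]] /orP[lm|/andP[/eqP<- lm]].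
- by rewrite (ltn_trans kl lm).
- by rewrite kl.
- by rewrite lm.
- by rewrite eqxx (le_trans kl lm) orbT.
Qed.

Lemma mi_le_anti : antisymmetric mi_le.
Proof.
move=> k l; rewrite /mi_le; case: (ltngtP (mi_deg k) (mi_deg l)) => //= _.
exact: le_anti.
Qed.

Lemma mi_le_refl : reflexive mi_le.
Proof. by move=> k; rewrite /mi_le eqxx lexx orbT. Qed.

Lemma mem_mi_upto n k : (k \in mi_upto n) = (mi_deg k <= n)%N.
Proof.
rewrite mem_sort mem_filter; case: leqP => //= kn.
have hk i : (tnth k i < n.+1)%N.
  by rewrite ltnS (leq_trans _ kn)// /mi_deg (bigD1 i)//= leq_addr.
apply/mapP; exists [tuple Ordinal (hk i) | i < s]; first by rewrite mem_enum.
by apply: eq_from_tnth => i; rewrite tnth_map tnth_mktuple.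
Qed.

Lemma mi_upto_uniq n : uniq (mi_upto n).
Proof.
rewrite sort_uniq filter_uniq// map_inj_uniq ?enum_uniq// => t u /(congr1 val)/=.
by move=> /(inj_map val_inj) tu; apply: val_inj.
Qed.

Lemma mi_upto_sorted n : sorted mi_le (mi_upto n).
Proof. exact/sort_sorted/mi_le_total. Qed.

Lemma mi_upto_prefix m n : (m <= n)%N -> exists t, mi_upto n = mi_upto m ++ t.
Proof.
move=> mn; pose p k := (mi_deg k <= m)%N.
pose a := seq.filter p (mi_upto n); pose b := seq.filter (predC p) (mi_upto n).
have sub_sorted q : sorted mi_le (seq.filter q (mi_upto n)).
  exact/(sorted_filter mi_le_trans)/mi_upto_sorted.
have aE : a = mi_upto m.
  apply: (sorted_eq mi_le_trans mi_le_anti).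
  - exact: sub_sorted.
  - exact: mi_upto_sorted.
  - apply: uniq_perm; rewrite ?filter_uniq ?mi_upto_uniq// => k.
    rewrite mem_filter !mem_mi_upto /p; case: leqP => //= km.
    exact: leq_trans km mn.
exists b; rewrite -aE.
apply: (sorted_eq mi_le_trans mi_le_anti); first exact: mi_upto_sorted.
- rewrite (sorted_pairwise mi_le_trans) pairwise_cat.
  rewrite -!(sorted_pairwise mi_le_trans) !sub_sorted !andbT.
  apply/allrelP => k l; rewrite !mem_filter /= /p -ltnNge.
  by move=> /andP[km _] /andP[ml _]; rewrite /mi_le (leq_ltn_trans km ml).
- by rewrite perm_sym; apply/permPl/perm_filterC.
Qed.

Hypothesis s_gt0 : (0 < s)%N.

Lemma size_mi_upto n : (n < size (mi_upto n))%N.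
Proof.
pose f (i : nat) : s.-tuple nat :=
  [tuple (if j == Ordinal s_gt0 then i else 0%N) | j < s].
have degf i : mi_deg (f i) = i.
  rewrite /mi_deg (bigD1 (Ordinal s_gt0))//= tnth_mktuple eqxx big1 ?addn0//.
  by move=> j /negPf hj; rewrite tnth_mktuple hj.
have finj : injective f by move=> i j /(congr1 mi_deg); rewrite !degf.
rewrite -[n.+1](size_iota 0) -(size_map f).
apply: uniq_leq_size; first by rewrite map_inj_uniq ?iota_uniq.
move=> _ /mapP[i i_n ->]; rewrite mem_mi_upto degf.
by rewrite mem_iota in i_n.
Qed.

Lemma mi_enumE m n : (m <= n)%N ->
  mi_enum m = nth (nseq_tuple s 0%N) (mi_upto n) m.
Proof. by move=> /mi_upto_prefix[t ->]; rewrite nth_cat size_mi_upto. Qed.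

Lemma mi_enum_le m n : mi_le (mi_enum m) (mi_enum n) = (m <= n)%N.
Proof.
have H i j : (i <= j)%N -> mi_le (mi_enum i) (mi_enum j).
  move=> ij; rewrite (mi_enumE ij) /mi_enum.
  apply: (sorted_leq_nth mi_le_trans mi_le_refl) => //.
  - exact: mi_upto_sorted.
  - exact: leq_ltn_trans ij (size_mi_upto j).
  - exact: size_mi_upto.
case: (leqP m n) => [/H//|nm]; apply/negP => mn.
have /eqP : mi_enum m = mi_enum n by apply: mi_le_anti; rewrite mn H// ltnW.
rewrite (mi_enumE (ltnW nm)) /mi_enum nth_uniq ?size_mi_upto ?mi_upto_uniq//.
- by rewrite gtn_eqF.
- exact: ltn_trans nm (size_mi_upto m).
Qed.

Lemma mi_enum_surj k : exists n, mi_enum n = k.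
Proof.
have kin : k \in mi_upto (mi_deg k) by rewrite mem_mi_upto.
set d := mi_deg k in kin; pose i := index k (mi_upto d).
exists i; rewrite (mi_enumE (leq_maxl i d)).
have [t ->] := mi_upto_prefix (leq_maxr i d).
by rewrite nth_cat index_mem kin nth_index.
Qed.

End GradedLex.

(* The regular module R[i]^o carries the normed topology of the complex plane,
   which the library does not attach to R[i] itself. *)
Notation Cplx R := (R[i]^o).

Definition boundary (T : topologicalType) (K : set T) : set T :=
  closure K `\` interior K.

Section Leja.
Variable R : realType.

Definition monomial (s : nat) (k : s.-tuple nat) (z : 'rV[Cplx R]_s) : Cplx R :=
  \prod_(j < s) z 0 j ^+ tnth k j.

(* The Vandermonde determinant of the first N points of H. *)
Definition VDM (s N : nat) (H : nat -> 'rV[Cplx R]_s) : Cplx R :=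
  \det (\matrix_(i < N, j < N) monomial (mi_enum s i) (H j)).

Definition intertwining (s : nat) (eta : 'I_s -> nat -> Cplx R) (n : nat) :
    'rV[Cplx R]_s :=
  \row_(j < s) eta j (tnth (mi_enum s n) j).

Definition prod_set (s : nat) (K : 'I_s -> set (Cplx R)) : set 'rV[Cplx R]_s :=
  [set z | forall j, K j (z 0 j)].

(* [Normc.normc] is the modulus with values in R, where [sup] is available. *)
Definition is_leja1 (K : set (Cplx R)) (eta : nat -> Cplx R) : Prop :=
  [/\ forall i, K (eta i),
      boundary K (eta 0%N)
    & forall k, (1 <= k)%N ->
        sup [set \prod_(i < k) Normc.normc (z - eta i) | z in K] =
        \prod_(i < k) Normc.normc (eta k - eta i)].

(* [[eta H with N |-> z]] is H_1, ..., H_N, z in one-based notation. *)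
Definition is_leja (s : nat) (K : set 'rV[Cplx R]_s)
    (H : nat -> 'rV[Cplx R]_s) : Prop :=
  [/\ forall n, K (H n),
      boundary K (H 0%N)
    & forall N, (1 <= N)%N ->
        Normc.normc (VDM N.+1 H) =
        sup [set Normc.normc (VDM N.+1 [eta H with N |-> z]) | z in K]].

End Leja.

(* Main.v *)
(** Newton interpolation.  For a multi-index [k] put
    [P_k(z) = prod_j prod_(i < k_j) (z_j - eta^(j)_i)].  It equals [z^k] plus a
    combination of monomials [z^l] with [l <= k] componentwise, hence [l] before
    [k] in the graded lexicographic order; and [P_k(eta_l) = 0] unless [k <= l]
    componentwise.  So passing from monomials to Newton polynomials makes the
    Vandermonde matrix triangular without changing its determinant, and
    [VDM(H_1, ..., H_N, z)] is a nonzero constant times [P_(k(N+1))(z)].  The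
    Leja condition at step [N] thus says that [|P_k|] is maximal at [eta_k] over
    the product, with [k = k(N+1)]: this follows factor by factor from (ii), and
    choosing [k] supported on one coordinate gives back (ii). *)

Require Import Defs.
From mathcomp Require Import all_boot all_order all_algebra.
From mathcomp Require Import all_classical all_reals all_analysis.
From mathcomp Require Import complex.

Set Implicit Arguments.
Unset Strict Implicit.

Import Order.TTheory GRing.Theory Num.Theory.
Import numFieldNormedType.Exports.
Local Open Scope classical_set_scope.
Local Open Scope ring_scope.

(** * Finite sums, moduli, suprema and the order on multi-indices *)

Lemma eq_sum_uniq_support (T : eqType) (V : nmodType) (F : T -> V)
    (r1 r2 : seq T) : uniq r1 -> uniq r2 ->
  (forall x, F x != 0 -> (x \in r1) && (x \in r2)) ->
  \sum_(x <- r1) F x = \sum_(x <- r2) F x.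
Proof.
move=> u1 u2 sF.
have restrict r : \sum_(x <- r) F x = \sum_(x <- [seq x <- r | F x != 0]) F x.
  rewrite big_filter [RHS]big_rmcond_in// => x _.
  by rewrite negbK => /eqP.
rewrite (restrict r1) (restrict r2); apply/perm_big/uniq_perm.
- exact: filter_uniq.
- exact: filter_uniq.
- move=> x; rewrite !mem_filter.
  by case: (boolP (F x != 0)) => //= /sF/andP[-> ->].
Qed.

Lemma normc_prod (R : rcfType) (I : Type) (r : seq I) (P : pred I)
    (F : I -> R[i]) :
  Normc.normc (\prod_(i <- r | P i) F i) =
  \prod_(i <- r | P i) Normc.normc (F i).
Proof. by apply: (big_morph _ (@Normc.normcM R)); exact: Normc.normc1. Qed.

Lemma normc_ge0 (R : rcfType) (x : R[i]) : 0 <= Normc.normc x.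
Proof. by case: x => a b; exact: sqrtr_ge0. Qed.

Lemma normc_eq0 (R : rcfType) (x : R[i]) : (Normc.normc x == 0) = (x == 0).
Proof.
apply/eqP/eqP => [|->]; first exact: Normc.eq0_normc.
exact: Normc.normc0.
Qed.

(* No boundedness is assumed: the supremum of a set that is not bounded above is
   0, so a nonzero value of [sup] already entails boundedness. *)
Lemma sup_eq_max (R : realType) (A : set R) (x : R) : A x -> x != 0 ->
  sup A = x <-> ubound A x.
Proof.
move=> Ax x0; split => [supx|ubx].
- have [supA|noA] := pselect (has_sup A).
    by rewrite -supx; exact: sup_upper_bound.
  by move: x0; rewrite -supx sup_out ?eqxx.
- apply/eqP; rewrite eq_le ge_sup//=; last by exists x.
  by apply: sup_upper_bound => //; split; exists x.
Qed.

(** The degree is monotone in each entry, and equal degrees then force [l = k], so the lexicographic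
    comparison is only ever made between equal tuples. *)
Lemma mi_le_componentwise (s : nat) (l k : s.-tuple nat) :
  (forall j, tnth l j <= tnth k j)%N -> mi_le l k.
Proof.
move=> lk.
have := @leqif_sum _ predT (fun j => tnth l j == tnth k j) (tnth l) (tnth k)
  (fun j _ => leqif_eq (lk j)).
rewrite /mi_le /mi_deg; set a := (\sum_i _)%N; set b := (\sum_i _)%N => -[ab eqab].
case: (ltngtP a b) (ab) (eqab) => //= _ _ /esym/forallP eqlk.
suff -> : l = k by rewrite lexx.
by apply: eq_from_tnth => j; apply/eqP/eqlk.
Qed.

(** * Multivariate Newton polynomials and the Vandermonde determinant *)

Section Newton.
Variables (R : realType) (s : nat) (eta : 'I_s -> nat -> Cplx R).
Implicit Types (k l : s.-tuple nat) (z : 'rV[Cplx R]_s).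

Definition newton_poly (x : nat -> Cplx R) (m : nat) : {poly Cplx R} :=
  \prod_(i < m) ('X - (x i)%:P).

Definition newton k z : Cplx R :=
  \prod_(j < s) \prod_(i < tnth k j) (z 0 j - eta j i).

(** The coefficient of z^l in P_k; it factors because P_k is a product of polynomials in separate
    variables. *)
Definition newton_coef k l : Cplx R :=
  \prod_(j < s) (newton_poly (eta j) (tnth k j))`_(tnth l j).

Lemma size_newton_poly x m : size (newton_poly x m) = m.+1.
Proof. by rewrite size_prod_XsubC /index_enum -enumT size_enum_ord. Qed.

Lemma horner_newton_poly x m c :
  (newton_poly x m).[c] = \prod_(i < m) (c - x i).
Proof. by rewrite horner_prod; apply: eq_bigr => i _; rewrite hornerXsubC. Qed.

Lemma newton_coef_le k l j : newton_coef k l != 0 -> (tnth l j <= tnth k j)%N.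
Proof.
apply: contraR; rewrite -ltnNge => kl; apply/prodf_eq0; exists j => //.
by rewrite nth_default// size_newton_poly.
Qed.

Lemma newton_coef_diag k : newton_coef k k = 1.
Proof.
apply: big1 => j _.
have /monicP := monic_prod_XsubC (index_enum 'I_(tnth k j)) xpredT (eta j).
by rewrite lead_coefE -/(newton_poly _ _) size_newton_poly.
Qed.

Lemma newton_expand n k z : mi_deg k = n ->
  newton k z = \sum_(l <- mi_upto s n) newton_coef k l * monomial l z.
Proof.
move=> kn.
have kjn j : (tnth k j <= n)%N by rewrite -kn /mi_deg (bigD1 j)//= leq_addr.
pose T (f : {ffun 'I_s -> 'I_n.+1}) : s.-tuple nat :=
  [tuple (f j : nat) | j < s].
have injT : injective T.
  move=> f g fg; apply/ffunP => j; apply: val_inj.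
  by have := congr1 (fun t => tnth t j) fg; rewrite !tnth_mktuple.
transitivity (\sum_(l <- [seq T f | f : {ffun 'I_s -> 'I_n.+1}])
    newton_coef k l * monomial l z).
  rewrite big_image/=.
  transitivity (\prod_(j < s) \sum_(t < n.+1)
      (newton_poly (eta j) (tnth k j))`_t * z 0 j ^+ t).
    apply: eq_bigr => j _; rewrite -horner_newton_poly.
    (* Padding every univariate expansion to length [n.+1] gives all the sums one index type, as
       distributivity requires. *)
    by rewrite (@horner_coef_wide _ n.+1) // size_newton_poly ltnS.
  rewrite bigA_distr_bigA/=; apply: eq_bigr => f _.
  rewrite /newton_coef /monomial -big_split/=.
  by apply: eq_bigr => j _; rewrite tnth_mktuple.
(* A nonzero coefficient forces [l] to be componentwise below [k], so [l] occurs both in the box of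
   exponents at most [n] and among the indices of degree at most [n]. *)
apply: eq_sum_uniq_support.
- by rewrite map_inj_uniq ?enum_uniq.
- exact: mi_upto_uniq.
move=> l; rewrite mulf_eq0 negb_or => /andP[/newton_coef_le lk _].
have lk' j : (tnth l j < n.+1)%N by rewrite ltnS (leq_trans (lk j)).
apply/andP; split.
- apply/fintype.imageP; exists [ffun j => Ordinal (lk' j)] => //.
  by apply: eq_from_tnth => j; rewrite tnth_mktuple ffunE.
- by rewrite mem_mi_upto -kn; apply: leq_sum => j _.
Qed.

Lemma newton_node_eq0 k (H : 'rV[Cplx R]_s) l j :
  H 0 j = eta j (tnth l j) -> (tnth l j < tnth k j)%N -> newton k H = 0.
Proof.
move=> Hj lk; apply/eqP/prodf_eq0; exists j => //.
by apply/prodf_eq0; exists (Ordinal lk) => //=; rewrite Hj subrr.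
Qed.

Hypothesis s_gt0 : (0 < s)%N.

Lemma mi_enum_inj : injective (mi_enum s).
Proof.
move=> m n mn; apply/eqP.
by rewrite eqn_leq -!(mi_enum_le s_gt0) mn mi_le_refl.
Qed.

Lemma newton_expand_enum N i z : (i <= N)%N ->
  newton (mi_enum s i) z =
  \sum_(n < N.+1) newton_coef (mi_enum s i) (mi_enum s n) *
    monomial (mi_enum s n) z.
Proof.
move=> iN; rewrite (@newton_expand _ _ _ erefl).
transitivity (\sum_(l <- [seq mi_enum s n | n <- iota 0 N.+1])
    newton_coef (mi_enum s i) l * monomial l z); last first.
  by rewrite big_map -{1}[N.+1]subn0 -/(index_iota 0 N.+1) big_mkord.
apply: eq_sum_uniq_support.
- exact: mi_upto_uniq.
- by rewrite map_inj_uniq ?iota_uniq//; exact: mi_enum_inj.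
move=> l; rewrite mulf_eq0 negb_or => /andP[/newton_coef_le lk _].
rewrite mem_mi_upto; apply/andP; split; first by apply: leq_sum => j _.
have [n nl] := mi_enum_surj s_gt0 l; apply/mapP; exists n => //.
have := mi_le_componentwise lk; rewrite -nl (mi_enum_le s_gt0) => ni.
by rewrite mem_iota add0n ltnS (leq_trans ni).
Qed.

Lemma VDM_newton N (H : nat -> 'rV[Cplx R]_s) :
  (forall n, (n < N)%N -> H n = intertwining eta n) ->
  VDM N.+1 H = (\prod_(n < N) newton (mi_enum s n) (intertwining eta n)) *
    newton (mi_enum s N) (H N).
Proof.
move=> HE.
pose A : 'M[Cplx R]_N.+1 :=
  \matrix_(i, n) newton_coef (mi_enum s i) (mi_enum s n).
pose M : 'M[Cplx R]_N.+1 := \matrix_(i, n) monomial (mi_enum s i) (H n).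
have detA : \det A = 1.
  rewrite det_trig; first by apply: big1 => i _; rewrite mxE newton_coef_diag.
  apply/is_trig_mxP => i n i_n; rewrite mxE; apply/eqP; apply: contraTT i_n.
  move=> /newton_coef_le lk; rewrite -leqNgt -(mi_enum_le s_gt0).
  exact: mi_le_componentwise.
have AM i n : (A *m M) i n = newton (mi_enum s i) (H n).
  rewrite (@newton_expand_enum N)// ?mxE; last by rewrite -ltnS ltn_ord.
  by apply: eq_bigr => m _; rewrite !mxE.
(* Row [i] of [A *m M] vanishes at the points of index less than [i]; transposing moves these zeros
   above the diagonal, where [det_trig] expects them. *)
transitivity (\det (A *m M)^T).
  by rewrite det_tr det_mulmx detA mul1r.
rewrite det_trig.
  rewrite big_ord_recr/= mxE AM/=; congr (_ * _).
  by apply: eq_bigr => n _; rewrite mxE AM HE//= ltn_ord.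
apply/is_trig_mxP => n i n_i; rewrite mxE AM.
(* The free point [H N] fills only the last row of the transpose, where no zero is required. *)
have nN : (n < N)%N by rewrite (leq_trans n_i)// -ltnS ltn_ord.
(* Otherwise k(i) would be componentwise below k(n), whence [i <= n]. *)
have [j lk] : exists j, (tnth (mi_enum s n) j < tnth (mi_enum s i) j)%N.
  apply: contrapT => /forallNP nlk; move: n_i.
  rewrite ltnNge -(mi_enum_le s_gt0) => /negP; apply.
  by apply: mi_le_componentwise => j; rewrite leqNgt; exact/negP/nlk.
by apply: newton_node_eq0 lk; rewrite HE// mxE.
Qed.

Hypothesis eta_inj : forall j, injective (eta j).

Lemma newton_intertwining_neq0 n :
  newton (mi_enum s n) (intertwining eta n) != 0.
Proof.
apply/prodf_neq0 => j _; apply/prodf_neq0 => i _; rewrite mxE subr_eq0.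
by rewrite (inj_eq (@eta_inj j)) gtn_eqF.
Qed.

Lemma leja_stepP (K : set 'rV[Cplx R]_s) N : K (intertwining eta N) ->
  Normc.normc (VDM N.+1 (intertwining eta)) =
    sup [set Normc.normc (VDM N.+1 [eta (intertwining eta) with N |-> z])
        | z in K] <->
  (forall z, K z -> Normc.normc (newton (mi_enum s N) z) <=
    Normc.normc (newton (mi_enum s N) (intertwining eta N))).
Proof.
move=> KN; set H := intertwining eta.
pose c := Normc.normc (\prod_(n < N) newton (mi_enum s n) (H n)).
have c_gt0 : 0 < c.
  rewrite lt_neqAle eq_sym normc_eq0 normc_ge0 andbT.
  by apply/prodf_neq0 => n _; exact: newton_intertwining_neq0.
have VH : Normc.normc (VDM N.+1 H) = c * Normc.normc (newton (mi_enum s N) (H N)).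
  by rewrite VDM_newton// Normc.normcM.
have Vz z : Normc.normc (VDM N.+1 [eta H with N |-> z]) =
    c * Normc.normc (newton (mi_enum s N) z).
  rewrite VDM_newton ?Normc.normcM /= ?eqxx// => n nN.
  by rewrite /= ltn_eqF.
rewrite VH.
set A := [set _ | _ in _]; set x := c * _.
have Ax : A x by exists (H N) => //; exact: Vz.
(* A nonzero value excludes the default 0 of [sup] on unbounded sets. *)
have x0 : x != 0.
  by rewrite mulf_neq0 ?(gt_eqF c_gt0)// normc_eq0 newton_intertwining_neq0.
split=> [/esym/(sup_eq_max Ax x0) ubA z Kz|ubA].
- rewrite -(ler_pM2l c_gt0) -Vz; apply: ubA; by exists z.
- apply/esym/(sup_eq_max Ax x0) => _ [z Kz <-].
  by rewrite Vz (ler_pM2l c_gt0) ubA.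
Qed.

Lemma normc_newton k z : Normc.normc (newton k z) =
  \prod_(j < s) \prod_(i < tnth k j) Normc.normc (z 0 j - eta j i).
Proof. by rewrite normc_prod; apply: eq_bigr => j _; exact: normc_prod. Qed.

End Newton.

(** * The Leja condition in one variable and the boundary of a product *)

Lemma leja1_stepP (R : realType) (K : set (Cplx R)) (x : nat -> Cplx R) k :
  injective x -> K (x k) ->
  sup [set \prod_(i < k) Normc.normc (z - x i) | z in K] =
    \prod_(i < k) Normc.normc (x k - x i) <->
  (forall z, K z -> \prod_(i < k) Normc.normc (z - x i) <=
    \prod_(i < k) Normc.normc (x k - x i)).
Proof.
move=> xinj Kx.
have x0 : \prod_(i < k) Normc.normc (x k - x i) != 0.
  apply/prodf_neq0 => i _.
  by rewrite normc_eq0 subr_eq0 (inj_eq xinj) gtn_eqF.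
set A := [set _ | _ in _].
have Ax : A (\prod_(i < k) Normc.normc (x k - x i)) by exists (x k).
split=> [/(sup_eq_max Ax x0) ubA z Kz|ubA].
- by apply: ubA; exists z.
- by apply/(sup_eq_max Ax x0) => _ [z Kz <-]; exact: ubA.
Qed.

(** Around an interior point of the product, moving coordinate [j] alone stays in the product, which
    would make [x 0 j] interior to [K j]. *)
Lemma boundary_prod_set (R : realType) (s : nat) (K : 'I_s -> set (Cplx R))
    (x : 'rV[Cplx R]_s) (j : 'I_s) :
  prod_set K x -> boundary (K j) (x 0 j) -> boundary (prod_set K) x.
Proof.
move=> Kx [_ nint]; split; first exact: subset_closure.
move=> /nbhs_ballP[e e0 He]; apply: nint; apply/nbhs_ballP; exists e => // w xw.
pose y : 'rV[Cplx R]_s := \row_i (if i == j then w else x 0 i).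
have : prod_set K y.
  apply: He; split=> // a i; rewrite ord1 mxE; case: eqP => [->//|_].
  exact: ballxx.
by move=> /(_ j); rewrite mxE eqxx.
Qed.

Theorem theorem1 (R : realType) (s : nat) (s_ge2 : (2 <= s)%N)
    (K : 'I_s -> set (Cplx R)) (eta : 'I_s -> nat -> Cplx R)
    (K_compact : forall j : 'I_s, compact (K j))
    (eta_in_K : forall (j : 'I_s) (i : nat), K j (eta j i))
    (eta_inj : forall j : 'I_s, injective (eta j))
    (eta0_boundary : forall j : 'I_s, boundary (K j) (eta j 0%N)) :
  is_leja (prod_set K) (intertwining eta) <->
  (forall j : 'I_s, is_leja1 (K j) (eta j)).
Proof.
have s_gt0 : (0 < s)%N by exact: ltnW.
have KH n : prod_set K (intertwining eta n) by move=> j; rewrite mxE.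
have mi0 : mi_enum s 0 = nseq_tuple s 0%N.
  have [n n0] := mi_enum_surj s_gt0 (nseq_tuple s 0%N).
  suff : (n <= 0)%N by rewrite leqn0 => /eqP n_0; rewrite -n0 n_0.
  rewrite -(mi_enum_le s_gt0) n0; apply: mi_le_componentwise => j.
  by rewrite (tnth_nth 0%N) nth_nseq if_same.
split=> [[_ _ leja] j|leja].
- split=> // k k_gt0; apply/(leja1_stepP (eta_inj j) (eta_in_K j k)) => w Kw.
  (* For this multi-index, P_k is the univariate Newton product of degree [k] in z_j. *)
  pose kk : s.-tuple nat := [tuple (if i == j then k else 0%N) | i < s].
  have [N Nk] := mi_enum_surj s_gt0 kk.
  have kkj : tnth kk j = k by rewrite tnth_mktuple eqxx.
  have N_gt0 : (0 < N)%N.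
    rewrite lt0n; apply/eqP => N0; move: k_gt0.
    by rewrite -kkj -Nk N0 mi0 (tnth_nth 0%N) nth_nseq if_same.
  have normE z : Normc.normc (newton eta (mi_enum s N) z) =
      \prod_(i < k) Normc.normc (z 0 j - eta j i).
    rewrite normc_newton Nk (bigD1 j)//= kkj [X in _ * X]big1 ?mulr1// => i ij.
    by rewrite tnth_mktuple (negPf ij) big_ord0.
  have /(leja_stepP s_gt0 eta_inj (KH N)) maxN := leja N N_gt0.
  (* The other coordinates do not affect P_k; any point of [K i] would do. *)
  pose z : 'rV[Cplx R]_s := \row_i (if i == j then w else eta i 0%N).
  have Kz : prod_set K z by move=> i; rewrite mxE; case: eqP => [->|_].
  by have := maxN z Kz; rewrite !normE !mxE eqxx Nk kkj.
- split=> //.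
    apply: (@boundary_prod_set _ _ _ _ (Ordinal s_gt0)) => //.
    by rewrite mxE mi0 (tnth_nth 0%N) nth_nseq if_same.
  move=> N _; apply/(leja_stepP s_gt0 eta_inj (KH N)) => z Kz.
  rewrite !normc_newton; apply: ler_prod => j _; apply/andP; split.
    by apply: prodr_ge0 => i _; exact: normc_ge0.
  (* The one-variable condition starts at degree 1; in degree 0 both products are empty. *)
  rewrite mxE; case: (posnP (tnth (mi_enum s N) j)) => [->|k_gt0].
    by rewrite !big_ord0.
  have [_ _ /(_ _ k_gt0)] := leja j.
  by move=> /(leja1_stepP (eta_inj j) (eta_in_K j _)); apply.
Qed.
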